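(* Let $n$ be a non-negative integer and let $F$ be the filter in the poset $I_{n}^{\bullet}$ of pointed integer partitions of $n$ generated by a pointed knapsack partition $\{\lambda,\underline{m}\}=\{\lambda_1,\dots,\lambda_p,\underline{m}\}$ of $n$. Let $C_{n}^{\bullet}(F)=\{\vec{c}\in C_{n}^{\bullet}:\mathrm{type}(\vec{c})\in F\}$ and let $\vec{c}=(c_1,\dots,c_{k-1},\underline{c_k})\in C_n^{\bullet}(F)$. Then in the lattice $C_{n}^{\bullet}(F)\cup\{\hat{0}\}$, $$\mu(\hat{0},\vec{c})=\begin{cases}(-1)^{p-k} & \text{if } \vec{c}\in V,\\ 0 & \text{otherwise.}\end{cases}$$
   Context: A pointed integer partition of $n$ is a pair $\{\lambda,\underline{m}\}=\{\lambda_1,\dots,\lambda_k,\underline{m}\}$ where $m\ge 0$ is an integer (the pointed part) and $\lambda$ is an integer partition (multiset of positive integers) of $n-m$. The poset $I_n^{\bullet}$ of all pointed integer partitions of $n$ is ordered by the cover relations: replacing two non-pointed parts by their sum, and replacing a non-pointed part $\lambda_k$ and the pointed part $m$ by the pointed part $\lambda_k+m$ (going up). The filter generated by an element $x$ is $\{y: x\le y\}$. A multiset $\lambda=\{e_1^{m_1},\dots,e_q^{m_q}\}$ of positive integers (distinct $e_i$ with multiplicities $m_i$) is a knapsack partition if the number of distinct integers of the form $\sum_{e\in\mu}e$, $\mu$ a sub-multiset of $\lambda$, equals $\prod_{i=1}^q(m_i+1)$; equivalently each such sum has a unique representation as a sum of a sub-multiset of $\lambda$. A pointed integer partition $\{\lambda,\underline{m}\}$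 is a pointed knapsack partition if $\lambda$ is a knapsack partition. A pointed composition of $n$ is a list $\vec{c}=(c_1,\dots,c_{k-1},\underline{c_k})$ of non-negative integers with sum $n$ where $c_1,\dots,c_{k-1}$ are positive. $C_n^{\bullet}$ is the poset of these with cover relations given by adding two adjacent entries (if the last entry is involved, the sum is the new last entry). The type of $\vec{c}$ is the pointed integer partition $\{c_1,\dots,c_{k-1},\underline{c_k}\}$. $\hat{0}$ denotes an adjoined minimum element. $V=V(\lambda,\underline{m})$ is the set of pointed compositions $\vec{c}=(c_1,\dots,c_{k-1},\underline{m})$ in $C_n^\bullet(F)$ (with last entry exactly $m$) such that, when each $c_i$ ($1\le i\le k-1$) is expressed (uniquely, by the knapsack property) as a sum of parts of $\lambda$, the summands for each $c_i$ are distinct (no value appears twice among the summands of a single $c_i$). *)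

(* Defs.v *)
From mathcomp Require Import all_boot all_order all_algebra.
Set Implicit Arguments. Unset Strict Implicit. Unset Printing Implicit Defensive.
Import GRing.Theory Num.Theory.

Definition drop_idx (i : nat) (s : seq nat) : seq nat := take i s ++ drop i.+1 s.

(* Pointed compositions: a pointed composition (c_1,...,c_{k-1},_c_k_)  *)
(* is represented by the list [:: c_1; ...; c_k]; the last entry is    *)
(* the pointed one.                                                    *)

Definition is_pcomp (n : nat) (c : seq nat) : bool :=
  match c with
  | [::] => false
  | x :: s => all (fun e => 0 < e) (belast x s) && (sumn c == n)
  end.

Definition ctype (c : seq nat) : seq nat * nat :=
  match c with
  | [::] => ([::], 0)
  | x :: s => (belast x s, last x s)
  end.

(* replace entries i and i+1 by their sum (if the last entry is involved
   the sum becomes the new last, i.e. pointed, entry) *)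
Definition cmerge (c : seq nat) (i : nat) : seq nat :=
  take i c ++ (nth 0 c i + nth 0 c i.+1) :: drop i.+2 c.

Fixpoint creach (j : nat) (c d : seq nat) : bool :=
  match j with
  | 0 => c == d
  | j'.+1 => has (fun i => creach j' (cmerge c i) d) (iota 0 (size c).-1)
  end.

(* order of C_n^bullet: reflexive-transitive closure of the covers.
   Every cover step shortens the list by one, so chains of covers
   starting at c have at most size c steps. *)
Definition cle (c d : seq nat) : bool :=
  has (fun j => creach j c d) (iota 0 (size c).+1).

Fixpoint allseqs (k m : nat) : seq (seq nat) :=
  match k with
  | 0 => [:: [::]]
  | k'.+1 => [::] :: [seq i :: s | i <- iota 0 m.+1, s <- allseqs k' m]
  end.

(* all pointed compositions of n (they have length <= n+1, entries <= n) *)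
Definition pcomps (n : nat) : seq (seq nat) :=
  undup (filter (is_pcomp n) (allseqs n.+1 n)).

(* Pointed integer partitions {lambda, _m_}: pairs (lambda, m), with    *)
(* lambda a list of positive integers considered up to permutation.     *)

Definition pp := (seq nat * nat)%type.

(* merge two non-pointed parts i < j *)
Definition ppmerge (x : pp) (i j : nat) : pp :=
  ((nth 0 x.1 i + nth 0 x.1 j) :: drop_idx i (drop_idx j x.1), x.2).

Definition ppabsorb (x : pp) (i : nat) : pp :=
  (drop_idx i x.1, x.2 + nth 0 x.1 i).

Definition ppeq (x y : pp) : bool := perm_eq x.1 y.1 && (x.2 == y.2).

Fixpoint ppreach (j : nat) (x y : pp) : bool :=
  match j with
  | 0 => ppeq x y
  | j'.+1 =>
      has (fun j1 => has (fun i => ppreach j' (ppmerge x i j1) y) (iota 0 j1))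
          (iota 0 (size x.1))
      || has (fun i => ppreach j' (ppabsorb x i) y) (iota 0 (size x.1))
  end.

(* order of I_n^bullet (each cover step removes one non-pointed part) *)
Definition pple (x y : pp) : bool :=
  has (fun j => ppreach j x y) (iota 0 (size x.1).+1).

Definition CF (n : nat) (lam : seq nat) (m : nat) : seq (seq nat) :=
  [seq c <- pcomps n | pple (lam, m) (ctype c)].

Fixpoint subsums (lam : seq nat) : seq nat :=
  match lam with
  | [::] => [:: 0]
  | x :: s => undup (subsums s ++ [seq y + x | y <- subsums s])
  end.

Definition knapsack (lam : seq nat) : bool :=
  size (subsums lam) == \prod_(e <- undup lam) (count_mem e lam).+1.

Definition pknapsack (n : nat) (lam : seq nat) (m : nat) : Prop :=
  all (fun e => 0 < e) lam /\ sumn lam + m = n /\ knapsack lam.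

(* c has last entry m and, for every non-pointed entry c_i, the
   (unique, by the knapsack property) sub-multiset of lam (given by a
   mask) summing to c_i has distinct summands *)
Definition inV (n : nat) (lam : seq nat) (m : nat) (c : seq nat) : Prop :=
  c \in CF n lam m /\ (ctype c).2 = m /\
  forall ci, ci \in (ctype c).1 ->
    forall b : seq bool, sumn (mask b lam) = ci -> uniq (mask b lam).

(* Moebius function mu(0hat, c) in S u {0hat}, where S is a finite     *)
(* poset (listed without duplicates) with order le, and 0hat is an      *)
(* adjoined minimum:                                                   *)
(*   mu(0hat,0hat) = 1,  mu(0hat,c) = - 1 - sum_{z in S, z < c} mu(0hat,z) *)
(* The fuel size S bounds the length of any strict chain in S.          *)

Fixpoint mob0_aux (T : eqType) (le : rel T) (S : seq T) (fuel : nat) (c : T)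
  : int :=
  match fuel with
  | 0 => 0
  | f.+1 => - 1 - \sum_(z <- S | le z c && (z != c)) mob0_aux le S f z
  end%R.

Definition mob0 (T : eqType) (le : rel T) (S : seq T) (c : T) : int :=
  mob0_aux le S (size S) c.

(* Main.v *)
(* The refinement order below a composition [c] is governed by the blocks of
   [lam] that make up its entries, and these blocks are determined by the
   knapsack property.  It suffices to check that the claimed values of the
   Moebius function sum to -1 over every lower interval, i.e. that the sum of
   [(-1) ^ size z] over the [z <= c] in V is [(-1) ^ (size lam + 1)].  Group the
   [z] by the set A of parts summing to the first entry of [z]: A is a nonempty
   subset of the support of the block belonging to the first entry of [c], and
   removing A from [lam], from [z] and from [c] gives the same situation for a
   smaller knapsack partition.  By induction, the claim reduces to
   [sum_A (-1) ^ |A| = -1] over nonempty subsets of a nonempty set. *)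

Require Import Defs.
From mathcomp Require Import all_boot all_order all_algebra zify ring.
Import GRing.Theory Num.Theory.
Set Implicit Arguments. Unset Strict Implicit. Unset Printing Implicit Defensive.

(** Turns permutation goals on concatenations into linear equations between multiplicities. *)
Ltac perm_count :=
  let p := fresh "p" in
  apply/permP => p;
  repeat match goal with
  | H : is_true (perm_eq _ _) |- _ => move: (permP H p); clear H
  end;
  rewrite /= ?count_cat /= ?count_cat /=; lia.

(** * Möbius values from sums over lower intervals *)

(** Solving the sum condition for [g c] gives the recursion of [mob0]. The fuel suffices because a
    [z] strictly below [c] has fewer elements below it: by antisymmetry [c] is not among them. *)
Lemma mob0_unique (T : eqType) (le : rel T) (S : seq T) (g : T -> int) :
  uniq S ->
  {in S, reflexive le} -> {in S & &, transitive le} ->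
  {in S &, antisymmetric le} ->
  {in S, forall c, \sum_(z <- S | le z c) g z = -1}%R ->
  {in S, mob0 le S =1 g}.
Proof.
move=> Su lexx letr leas gsum c0 c0S; rewrite /mob0.
have: (count (le^~ c0) S <= size S)%N by exact: count_size.
elim: (size S) c0 c0S => [|f IH] c cS.
  rewrite leqn0 -leqn0 leqNgt -has_count; case/hasP.
  by exists c => //; exact: lexx.
move=> cnt /=.
have -> : (\sum_(z <- S | le z c && (z != c)) mob0_aux le S f z
         = \sum_(z <- S | le z c && (z != c)) g z)%R.
  rewrite big_seq_cond [RHS]big_seq_cond; apply: eq_bigr => z /and3P[zS zc nzc].
  apply: IH => //; rewrite -ltnS; apply: leq_trans cnt.
  have sub : {subset [seq w <- S | le w z] <= [seq w <- S | le w c & w != c]}.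
    move=> w; rewrite !mem_filter => /andP[wz wS]; rewrite wS andbT.
    rewrite (letr z w c zS wS cS wz zc); apply: contra nzc => /eqP wc.
    by rewrite wc in wz; apply/eqP/leas => //; rewrite zc wz.
  have := uniq_leq_size (filter_uniq _ Su) sub.
  rewrite !size_filter => h; apply: leq_ltn_trans h _.
  have -> : count (le^~ c) S = count (fun w => le w c && (w != c)) S + 1.
    have -> : 1%N = count_mem c [seq w <- S | le w c].
      by rewrite count_uniq_mem ?filter_uniq // mem_filter cS lexx.
    rewrite -size_filter -(count_predC (pred1 c)) addnC.
    congr (_ + _)%N; rewrite count_filter; apply: eq_count => w /=.
    by rewrite andbC.
  by rewrite addn1.
have cF : c \in [seq z <- S | le z c] by rewrite mem_filter cS lexx.
have := gsum c cS; rewrite -big_filter (bigD1_seq c) ?filter_uniq //=.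
by rewrite big_filter_cond => <-; ring.
Qed.

(** * Refinement of lists and the order [cle] *)

(** A step-free form of [cle]: the finer list is cut into nonempty runs of adjacent entries, one for
    each entry of the coarser list. *)
Inductive refines : seq nat -> seq nat -> Prop :=
| refines_nil : refines [::] [::]
| refines_cons u s t :
    u != [::] -> refines s t -> refines (u ++ s) (sumn u :: t).

Lemma refines_refl s : refines s s.
Proof.
elim: s => [|x s IH]; first exact: refines_nil.
by have := @refines_cons [:: x] s s isT IH; rewrite /= addn0.
Qed.

Lemma refines_size s t : refines s t -> size t <= size s ?= iff (s == t).
Proof.
elim=> [|[|x u] {}s {}t //= _ _ IH]; first by split.
have h := leqif_geq (leq0n (size u)).
rewrite size_cat -addnS; case: IH => le1 e1; split; first by lia.
rewrite eqseq_cons; case: u h => [|y u] h /=; first by rewrite addn0 !eqxx -e1; lia.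
have -> : (x == x + (y + sumn u)) && (y :: u ++ s == t) = false; last by lia.
by apply/negP => /andP[_ /eqP e]; move: le1; rewrite -e /= size_cat; lia.
Qed.

Lemma refines_antisym s t : refines s t -> refines t s -> s = t.
Proof.
move=> /refines_size[le1 e1] /refines_size[le2 _].
by apply/eqP; rewrite -e1 eqn_leq le1.
Qed.

Lemma refines_sumn s t : refines s t -> sumn s = sumn t.
Proof. by elim=> //= u {}s {}t _ _ IH; rewrite sumn_cat IH. Qed.

Lemma refines_nilL s t : refines s t -> (s == [::]) = (t == [::]).
Proof. by case=> // -[|? ?]. Qed.

Lemma refines_catR s u t : refines s (u ++ t) ->
  exists s1 s2, [/\ s = s1 ++ s2, refines s1 u & refines s2 t].
Proof.
elim: u s => [|x u IH] s /= h.
  by exists [::], s; split=> //; exact: refines_nil.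
inversion h as [|v r t' v0 hr]; subst.
have [s1 [s2 [-> h1 h2]]] := IH _ hr.
by exists (v ++ s1), s2; rewrite catA; split=> //; exact: refines_cons.
Qed.

Lemma refines_trans s t r : refines s t -> refines t r -> refines s r.
Proof.
move=> st tr; elim: tr s st => [|u {}t {}r u0 _ IH] s // st.
have [s1 [s2 [-> h1 h2]]] := refines_catR st.
rewrite -(refines_sumn h1); apply: refines_cons; last exact: IH.
by rewrite (refines_nilL h1).
Qed.

Lemma cmerge_cons x s i : cmerge (x :: s) i.+1 = x :: cmerge s i.
Proof. by []. Qed.

Lemma refines_cmerge s i : i < (size s).-1 -> refines s (cmerge s i).
Proof.
elim: i s => [|i IH] [|x [|y s]] // hi.
  have := @refines_cons [:: x; y] s s isT (refines_refl s).
  by rewrite /cmerge /= drop0 addn0.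
have := @refines_cons [:: x] (y :: s) _ isT (IH (y :: s) hi).
by rewrite cmerge_cons /= addn0.
Qed.

(** The first run with at least two entries provides the merge; if all runs are singletons, the
    lists agree. *)
Lemma refines_step s t : refines s t ->
  s = t \/ exists2 i, i < (size s).-1 & refines (cmerge s i) t.
Proof.
elim=> [|[|x [|y u]] {}s {}t // _ st IH]; first by left.
  have xs := fun r => @refines_cons [:: x] r t isT.
  rewrite /= addn0 in xs *; case: IH => [->|[i hi hr]]; first by left.
  by right; exists i.+1; [lia|exact: xs].
right; exists 0 => //.
have := @refines_cons (x + y :: u) s t isT st.
by rewrite /cmerge /= drop0 addnA.
Qed.

Lemma cleP s t : reflect (refines s t) (cle s t).
Proof.
apply: (iffP hasP) => [[j _]|].
  elim: j s => [|j IH] s /=; first by move=> /eqP ->; exact: refines_refl.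
  case/hasP=> i; rewrite mem_iota add0n => hi /IH.
  by apply: refines_trans; exact: refines_cmerge.
move=> st; suff [j le_j hj]: exists2 j, j <= size s & creach j s t.
  by exists j; rewrite // mem_iota.
have [k] := ubnP (size s); elim: k s st => // k IH s st sk.
case: (refines_step st) => [->|[i hi hr]]; first by exists 0 => //=.
have sz : size (cmerge s i) < size s.
  by rewrite size_cat /= size_takel ?size_drop; lia.
have [|j le_j hj] := IH _ hr; first by lia.
exists j.+1; first by lia.
by apply/hasP; exists i; rewrite // mem_iota.
Qed.

(** * Splittings of a multiset into the entries of a composition *)

(* [splits P Q m L c]: the multiset [L] is cut into one block satisfying [P]
   per non-pointed entry of [c] and a block satisfying [Q] which, together with
   [m], makes up the pointed entry. *)
Inductive splits (P Q : pred (seq nat)) (m : nat) : seq nat -> seq nat -> Prop :=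
| splits_last L E : perm_eq L E -> Q E -> splits P Q m L [:: sumn E + m]
| splits_cons L A D c : perm_eq L (A ++ D) -> A != [::] -> P A ->
    splits P Q m D c -> splits P Q m L (sumn A :: c).

Lemma splits_perm P Q m (L L' : seq nat) c :
  perm_eq L L' -> splits P Q m L c -> splits P Q m L' c.
Proof.
rewrite perm_sym => LL' h.
case: h LL' => [{}L E|{}L A D {}c] hp; [move=> q|move=> a0 pA h] => LL'.
  by apply: splits_last => //; exact: perm_trans LL' hp.
by apply: splits_cons a0 pA h; exact: perm_trans LL' hp.
Qed.

Lemma splits_sub (P Q P' Q' : pred (seq nat)) m L c :
  subpred P P' -> subpred Q Q' -> splits P Q m L c -> splits P' Q' m L c.
Proof.
move=> PP' QQ'; elim=> {L c} [L E hp q|L A D c hp a0 pA _ IH].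
  by apply: splits_last => //; exact: QQ'.
by apply: splits_cons hp a0 (PP' _ pA) IH.
Qed.

Lemma splits_sumn P Q m L c : splits P Q m L c -> sumn c = sumn L + m.
Proof.
elim=> {L c} [L E hp _|L A D c hp _ _ _ IH] /=; rewrite (perm_sumn hp).
  by rewrite addn0.
by rewrite sumn_cat IH addnA.
Qed.

Lemma splits_nilN P Q m L : ~ splits P Q m L [::].
Proof. by move=> h; inversion h. Qed.

Lemma sumn_gt0 A : all (leq 1) A -> A != [::] -> 0 < sumn A.
Proof. by case: A => //= x A /andP[x0 _] _; rewrite addn_gt0 x0. Qed.

Lemma splits_size P Q m L c : splits P Q m L c -> size c <= (size L).+1.
Proof.
elim=> {L c} // L A D c hp a0 _ _ IH; rewrite (perm_size hp) size_cat /=.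
by case: A a0 {hp} => //= *; lia.
Qed.

Lemma splits_is_pcomp P Q m L c : all (leq 1) L -> splits P Q m L c ->
  is_pcomp (sumn L + m) c.
Proof.
move=> L0 h; rewrite -(splits_sumn h).
suff: all (leq 1) (belast (head 0 c) (behead c)).
  by case: c h => [/splits_nilN //|x s] _ /= ->; rewrite eqxx.
elim: h L0 => {L c} // L A D c hp a0 _ h IH.
rewrite (perm_all _ hp) all_cat => /andP[A0 /IH].
by case: c h {IH} => [/splits_nilN //|x s] _ /= ->; rewrite sumn_gt0.
Qed.

(** With no condition on the blocks, this describes the compositions whose type lies in the filter
    generated by the parts [L] and the pointed part [m]. *)
Notation fits := (splits predT predT).

(** The part [a + b] lies in some block, where [a] and [b] can replace it without changing the
    sum. *)
Lemma fits_merge m a b R c :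
  fits m (a + b :: R) c -> fits m [:: a, b & R] c.
Proof.
(* The multiset becomes a variable up to permutation, so that the induction can pass to the part of
   it outside the first block. *)
have [L hL] : exists L, perm_eq L (a + b :: R) by exists (a + b :: R).
rewrite perm_sym in hL => /(splits_perm hL) h; rewrite perm_sym in hL.
elim: h R hL => {L c} [L E hp _|L A D c hp a0 _ h IH] R hL.
  have -> : sumn E = sumn [:: a, b & R].
    by rewrite -(perm_sumn hp) (perm_sumn hL) /= addnA.
  by apply: splits_last.
have: a + b \in A ++ D by rewrite -(perm_mem hp) (perm_mem hL) mem_head.
rewrite mem_cat => /orP[] /perm_to_rem.
  set A' := rem _ _ => hA.
  have -> : sumn A = sumn [:: a, b & A'] by rewrite (perm_sumn hA) /= addnA.
  by apply: splits_cons h => //; perm_count.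
set D' := rem _ _ => hD.
apply: splits_cons (IH _ hD) => //; perm_count.
Qed.

Lemma fits_absorb m a R c : fits (m + a) R c -> fits m (a :: R) c.
Proof.
elim=> {R c} [R E hp _|R A D c hp a0 _ h IH].
  have -> : sumn E + (m + a) = sumn (a :: E) + m by rewrite /=; lia.
  by apply: splits_last; rewrite ?perm_cons.
by apply: splits_cons IH => //; perm_count.
Qed.

Lemma fits_ppeq m L c : c != [::] -> ppeq (L, m) (ctype c) -> fits m L c.
Proof.
case: c => // x s _ /andP[/= hp /eqP ->].
elim: s x L hp => [|y s IH] x L /= hp.
  by have := @splits_last predT predT x L [::] hp isT.
have := @splits_cons predT predT (last y s) L [:: x] (belast y s) (y :: s).
by rewrite /= addn0; apply=> //; exact: IH.
Qed.

(** The type is reached once all blocks are singletons and the last one is empty. Otherwise a block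
    with two parts allows a merge, or a nonempty last block an absorption. *)
Lemma fits_step m L c : fits m L c ->
  [\/ ppeq (L, m) (ctype c),
      exists a b R, perm_eq L [:: a, b & R] /\ fits m (a + b :: R) c |
      exists a R, perm_eq L (a :: R) /\ fits (m + a) R c].
Proof.
elim=> {L c} [L [|a E] hp _|L A D c hp a0 _ h IH].
- by constructor 1; rewrite /ppeq /= hp eqxx.
- constructor 3; exists a, E; split=> //=.
  have -> : a + sumn E + m = sumn E + (m + a) by lia.
  exact: splits_last.
case: A a0 hp => [|a [|b A]] //= _ hp.
  have cons1 m' L' D' : perm_eq L' (a :: D') -> fits m' D' c ->
      fits m' L' (a + 0 :: c).
    by move=> h1 h2; exact: (@splits_cons _ _ m' L' [:: a] D' c h1 isT isT h2).
  rewrite /= addn0 in cons1 *.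
  case: IH => [|[x [y [R [hD hR]]]]|[x [R [hD hR]]]].
  - constructor 1; move: p; rewrite /ppeq.
    case: c h {cons1} => [/splits_nilN //|x s] _ /= /andP[hD ->]; rewrite andbT.
    by perm_count.
  - constructor 2; exists x, y, (a :: R); split; first by perm_count.
    by apply: cons1 _ hR; perm_count.
  constructor 3; exists x, (a :: R); split; first by perm_count.
  by apply: cons1 _ hR; perm_count.
constructor 2; exists a, b, (A ++ D); split=> //.
rewrite addnA; apply: (@splits_cons predT predT m _ (a + b :: A) D c) => //.
Qed.

(** * Positions in lists and the order [pple] *)

Lemma perm_drop_idx i (s : seq nat) : i < size s -> perm_eq s (nth 0 s i :: drop_idx i s).
Proof.
move=> hi; rewrite /drop_idx -{1}(cat_take_drop i s) (drop_nth 0 hi).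
by rewrite -cat1s -[nth 0 s i :: _]cat1s perm_catCA.
Qed.

Lemma nth_drop_idx i j (s : seq nat) : i < j < size s -> nth 0 (drop_idx j s) i = nth 0 s i.
Proof.
by move=> /andP[ij js]; rewrite nth_cat size_takel ?ij ?nth_take // ltnW.
Qed.

Lemma size_drop_idx i (s : seq nat) : i < size s -> size (drop_idx i s) = (size s).-1.
Proof. by move=> /perm_drop_idx/perm_size ->. Qed.

Lemma perm_drop2 i j (s : seq nat) : i < j < size s ->
  perm_eq s [:: nth 0 s i, nth 0 s j & drop_idx i (drop_idx j s)].
Proof.
move=> /andP[ij js].
have h1 := perm_drop_idx js.
have /perm_drop_idx : i < size (drop_idx j s) by rewrite size_drop_idx //; lia.
rewrite nth_drop_idx ?ij // => h2; perm_count.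
Qed.

Lemma perm_idx1 (L : seq nat) (a : nat) (R : seq nat) : perm_eq L (a :: R) ->
  exists2 i, i < size L & nth 0 L i = a /\ perm_eq R (drop_idx i L).
Proof.
move=> hp; have aL : a \in L by rewrite (perm_mem hp) mem_head.
exists (index a L); rewrite ?index_mem // nth_index //; split=> //.
rewrite -(perm_cons a) -{2}(nth_index 0 aL) perm_sym.
by rewrite -(permPl (perm_drop_idx _)) ?index_mem.
Qed.

Lemma perm_idx2 (L : seq nat) (a b : nat) (R : seq nat) : perm_eq L [:: a, b & R] ->
  exists i j, [/\ i < j, j < size L &
    perm_eq (a + b :: R) (ppmerge (L, 0) i j).1].
Proof.
move=> hp; have [i0 i0L [ei hi]] := perm_idx1 hp.
have bM : b \in drop_idx i0 L by rewrite -(perm_mem hi) mem_head.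
(* A position in the list without entry [i0] is turned back into one of [L]; those from [i0] on
   shift by one. *)
have [j0 [j0L nij ej]] : exists j0, [/\ j0 < size L, i0 != j0 & nth 0 L j0 = b].
  move: bM; rewrite mem_cat => /orP[] /(nthP 0)[k].
    rewrite size_takel => [kl|]; last exact: ltnW.
    rewrite nth_take // => <-; exists k; split=> //.
      exact: ltn_trans i0L.
    by rewrite neq_ltn kl orbT.
  rewrite size_drop nth_drop => kl <-; exists (i0.+1 + k); split=> //.
    by rewrite -ltn_subRL.
  by rewrite neq_ltn ltnS leq_addr.
wlog ij : i0 j0 a b hp i0L j0L nij ei ej {hi bM} / i0 < j0 => [W|].
  case: (ltngtP i0 j0) => ij; [exact: (W i0 j0)| |by rewrite ij eqxx in nij].
  rewrite addnC; apply: (W j0 i0) => //; last by rewrite eq_sym.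
  by perm_count.
exists i0, j0; split=> //=; rewrite ei ej perm_cons.
have := @perm_drop2 i0 j0 L; rewrite ij j0L ei ej => /(_ isT) h.
by perm_count.
Qed.

(** Covers are undone by [fits_merge] and [fits_absorb]; conversely [fits_step] produces them, and
    each removes one part, so [size L] steps suffice. *)
Lemma ppleP L m c : c != [::] -> reflect (fits m L c) (pple (L, m) (ctype c)).
Proof.
move=> c0; apply: (iffP hasP) => [[j _]|].
  elim: j L m => [|j IH] L m; first exact: fits_ppeq.
  case/orP=> /hasP[j1]; rewrite mem_iota add0n => hj.
    case/hasP=> i; rewrite mem_iota add0n => /= hi /IH /fits_merge.
    apply: splits_perm; rewrite perm_sym perm_drop2 //.
    by rewrite hi.
  move/IH=> /fits_absorb; apply: splits_perm; rewrite perm_sym.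
  exact: perm_drop_idx.
move=> h; suff [j le_j hj]: exists2 j, j <= size L & ppreach j (L, m) (ctype c).
  by exists j; rewrite // mem_iota.
have [k] := ubnP (size L); elim: k L m h => // k IH L m h sk.
case: (fits_step h) => [hp|[a [b [R [hp hR]]]]|[a [R [hp hR]]]].
- by exists 0.
- have [i [j1 [ij jL hM]]] := perm_idx2 hp.
  have sz := perm_size hM; have szL := perm_size hp.
  case: (IH _ _ (splits_perm hM hR)) => [|j le_j hj].
    by rewrite -sz; move: szL sk => /= ->; lia.
  exists j.+1; first by move: szL sz le_j => /= -> <-; lia.
  apply/orP; left; apply/hasP; exists j1; rewrite ?mem_iota //.
  by apply/hasP; exists i; rewrite ?mem_iota.
have [i iL [ei hM]] := perm_idx1 hp.
have sz := perm_size hM; have szL := perm_size hp.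
case: (IH _ _ (splits_perm hM hR)) => [|j le_j hj].
  by rewrite -sz; move: szL sk => /= ->; lia.
exists j.+1; first by move: szL sz le_j => /= -> <-; lia.
apply/orP; right; apply/hasP; exists i; rewrite ?mem_iota //.
by rewrite /ppabsorb /= ei.
Qed.

(** * Enumeration of the filter [CF] *)

Lemma mem_allseqs k m s : size s <= k -> all (fun e => e <= m) s ->
  s \in allseqs k m.
Proof.
elim: k s => [|k IH] [|x s] // sk /andP[xm hs].
have h := allpairs_f cons (_ : x \in iota 0 m.+1) (IH s sk hs).
by rewrite in_cons h ?orbT // mem_iota.
Qed.

Lemma mem_pcomps n c : (c \in pcomps n) = is_pcomp n c.
Proof.
rewrite mem_undup mem_filter; case h : is_pcomp => //; rewrite andTb.
case: c h => // x s /andP[pos /eqP sn].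
apply: mem_allseqs.
  (* The non-pointed entries are positive, so there are at most [n] of them; the pointed one
     accounts for the length bound [n.+1]. *)
  have: size (belast x s) <= sumn (belast x s).
    by elim: (belast x s) pos => //= y t IH /andP[? /IH]; lia.
  by rewrite -sn lastI sumn_rcons size_rcons ltnS => /leq_trans; apply; exact: leq_addr.
apply/allP => e eS; rewrite -sn (perm_sumn (perm_to_rem eS)) /=; exact: leq_addr.
Qed.

Lemma CFP L m c : all (leq 1) L ->
  reflect (fits m L c) (c \in CF (sumn L + m) L m).
Proof.
move=> L0; rewrite mem_filter mem_pcomps.
case: c => [|x s]; first by rewrite andbF; constructor; exact: splits_nilN.
apply: (iffP andP) => [[/ppleP h _]|h]; first exact: h.
by split; [apply/ppleP|exact: splits_is_pcomp h].
Qed.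

(** * Uniqueness of subset sums from the knapsack property *)

Definition unique_sums (L : seq nat) :=
  forall A A' D D', perm_eq L (A ++ D) -> perm_eq L (A' ++ D') ->
  sumn A = sumn A' -> perm_eq A A'.

Lemma unique_sums_sub (L A D : seq nat) :
  perm_eq L (A ++ D) -> unique_sums L -> unique_sums D.
Proof.
move=> hp hL B B' E E' hB hB' /hL; apply.
  by instantiate (1 := A ++ E); perm_count.
by instantiate (1 := A ++ E'); perm_count.
Qed.

(* One representative of each submultiset of [L] when [es] is the support. *)
Fixpoint submultisets (L es : seq nat) : seq (seq nat) :=
  match es with
  | [::] => [:: [::]]
  | e :: es' => [seq nseq i e ++ r | i <- iota 0 (count_mem e L).+1,
                                    r <- submultisets L es']
  end.

Lemma size_submultisets L es :
  size (submultisets L es) = \prod_(e <- es) (count_mem e L).+1.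
Proof.
elim: es => [|e es IH]; first by rewrite big_nil.
rewrite big_cons -IH -[in RHS](size_iota 0 (count_mem e L).+1).
exact: (size_allpairs (fun i r => nseq i e ++ r)).
Qed.

(** The representative of [A] listed by [submultisets]. *)
Definition normal_form (A es : seq nat) :=
  flatten [seq nseq (count_mem e A) e | e <- es].

Lemma mem_normal_form (L A D es : seq nat) : perm_eq L (A ++ D) ->
  normal_form A es \in submultisets L es.
Proof.
move=> hp; elim: es => // e es IH.
apply: (allpairs_f (fun i r => nseq i e ++ r) _ IH).
by rewrite mem_iota (permP hp) count_cat add0n ltnS leq_addr.
Qed.

Lemma perm_normal_form (L A D : seq nat) : perm_eq L (A ++ D) ->
  perm_eq (normal_form A (undup L)) A.
Proof.
move=> hp; apply/allP => x _; apply/eqP.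
have cnt : forall es, uniq es ->
    count_mem x (normal_form A es) = (x \in es) * count_mem x A.
  elim=> //= e es IH /andP[ne ues]; rewrite count_cat count_nseq IH // in_cons /=.
  rewrite [x == e]eq_sym; case: eqP ne => [<- /negPf ->|_ _] //=.
  by rewrite addn0.
rewrite cnt ?undup_uniq // mem_undup (perm_mem hp) mem_cat.
have := has_pred1 x A; rewrite has_count; case: (x \in A) => //=.
  by rewrite mul1n.
by case: count => // _; rewrite muln0.
Qed.

Lemma mem_subsums L x : x \in subsums L -> exists2 A, subseq A L & sumn A = x.
Proof.
elim: L x => [|y L IH] x /=; first by rewrite inE => /eqP ->; exists [::].
rewrite mem_undup mem_cat => /orP[/IH[A hA <-]|/mapP[z /IH[A hA <-] ->]].
  by exists A => //; exact: (subseq_trans hA (subseq_cons L y)).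
by exists (y :: A); rewrite /= ?eqxx // addnC.
Qed.

(** The product in [knapsack] counts the submultisets. As [sumn] maps them onto the subset sums and
    the two numbers agree, no sum occurs twice. *)
Lemma knapsack_unique L : knapsack L -> unique_sums L.
Proof.
rewrite /knapsack -size_submultisets => /eqP sz.
have us : uniq (subsums L) by case: L {sz} => //= *; exact: undup_uniq.
have um : uniq (map sumn (submultisets L (undup L))).
  apply: leq_size_uniq us _ _; last by rewrite size_map sz.
  move=> _ /mem_subsums[A /perm_to_subseq[D hp] <-].
  rewrite -(perm_sumn (perm_normal_form hp)); apply: map_f.
  exact: mem_normal_form hp.
have inj : {in submultisets L (undup L) &, injective sumn}.
  elim: submultisets um => //= B s IH /andP[nB us'] B1 B2.
  rewrite !inE => /predU1P[->|h1] /predU1P[->|h2] // e.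
  - by rewrite e map_f in nB.
  - by rewrite -e map_f in nB.
  exact: IH.
move=> A A' D D' hp hp' e.
rewrite -(permPl (perm_normal_form hp)) -(permPr (perm_normal_form hp')).
rewrite (inj (normal_form A (undup L)) (normal_form A' (undup L))) //.
- exact: mem_normal_form hp.
- exact: mem_normal_form hp'.
by rewrite (perm_sumn (perm_normal_form hp)) (perm_sumn (perm_normal_form hp')).
Qed.

(** * Alternating sums over subsets *)

Fixpoint sublists (T : Type) (s : seq T) : seq (seq T) :=
  if s is x :: s' then sublists s' ++ map (cons x) (sublists s') else [:: [::]].

Lemma mem_sublists (T : eqType) (A s : seq T) :
  (A \in sublists s) = subseq A s.
Proof.
elim: s A => [|x s IH] A; first by rewrite inE; case: A.
rewrite mem_cat IH; case: A => [|y A]; first by rewrite !sub0seq.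
rewrite [RHS]/=; case: eqP => [->|ne].
  rewrite mem_map ?IH; last by move=> ? ? [].
  apply/orP/idP => [[|//]|]; last by right.
  by apply: subseq_trans; exact: subseq_cons.
case: (boolP (_ \in map _ _)); last by rewrite orbF.
by case/mapP => B _ [].
Qed.

Lemma uniq_sublists (T : eqType) (s : seq T) : uniq s -> uniq (sublists s).
Proof.
elim: s => //= x s IH /andP[xs us].
rewrite cat_uniq IH // map_inj_uniq ?IH // ?andbT; last by move=> ? ? [].
apply/hasPn => _ /mapP[B _ ->]; rewrite mem_sublists.
by apply: contra xs => /mem_subseq; apply; exact: mem_head.
Qed.

(** Sublists with and without the first element cancel in pairs; leaving out the empty one gives
    -1. *)
Lemma sign_sublists (R : pzRingType) (T : eqType) (s : seq T) : s != [::] -> uniq s ->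
  (\sum_(A <- sublists s | A != [::]) (-1) ^+ size A = -1 :> R)%R.
Proof.
case: s => // x s _ us.
have : (\sum_(A <- sublists (x :: s)) (-1) ^+ size A = 0 :> R)%R.
  rewrite big_cat big_map /= -big_split big1 //= => A _.
  by rewrite exprS mulN1r subrr.
rewrite (bigD1_seq [::]) ?mem_sublists ?sub0seq ?uniq_sublists //=.
by move=> /eqP; rewrite addrC addr_eq0 expr0 => /eqP.
Qed.

(** * Splittings into sets and removal of the first block *)

(** Describes V: blocks without repetition, and an empty last block, so that the pointed entry is
    [m]. *)
Notation setsplits := (splits (@uniq _) (@nilp _)).

Lemma splits_single P Q m L x : splits P Q m L [:: x] ->
  exists E, [/\ perm_eq L E, Q E & x = sumn E + m].
Proof.
move=> h; inversion h as [L' E hp q|L' A D c hp a0 pA hs]; subst.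
  by exists E.
by case: (splits_nilN hs).
Qed.

Lemma splits_consE P Q m L x s : s != [::] -> splits P Q m L (x :: s) ->
  exists A D, [/\ perm_eq L (A ++ D), A != [::], P A, x = sumn A &
                  splits P Q m D s].
Proof.
move=> s0 h; inversion h as [L' E hp q|L' A D c hp a0 pA hs]; subst => //.
by exists A, D.
Qed.

Lemma splits_nil P Q m c : splits P Q m [::] c -> c = [:: m].
Proof.
move=> h; inversion h as [L E hp q|L A D d hp a0 pA hs]; subst.
  by move: hp; rewrite perm_sym => /perm_nilP ->.
by move: hp; rewrite perm_sym => /perm_nilP; case: A a0 {pA h}.
Qed.

Lemma setsplits_head m L z : L != [::] -> setsplits m L z ->
  exists A D z', [/\ perm_eq L (A ++ D), A != [::], uniq A, setsplits m D z' &
                     z = sumn A :: z'].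
Proof.
move=> L0 h; case: h L0 => [{}L [|//] /perm_nilP -> //|{}L A D z' *].
by exists A, D, z'.
Qed.

Lemma setsplits_cat m L u r : r != [::] -> setsplits m L (u ++ r) ->
  exists U R, [/\ perm_eq L (U ++ R), sumn U = sumn u & setsplits m R r].
Proof.
move=> r0; elim: u L => [|x u IH] L /= h; first by exists [::], L.
have [|A [D [hp _ _ -> /IH[U [R [hp' <- hR]]]]]] := splits_consE _ h.
  by case: u {h IH}.
exists (A ++ U), R; split=> //; last by rewrite sumn_cat.
perm_count.
Qed.

Lemma all_perm_cat (a : pred nat) (L A D : seq nat) :
  perm_eq L (A ++ D) -> all a L = all a A && all a D.
Proof. by move=> hp; rewrite (perm_all _ hp) all_cat. Qed.

Lemma undup_sub (A B L : seq nat) : uniq A -> perm_eq L (A ++ B) ->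
  exists2 A', subseq A' (undup L) & perm_eq A A'.
Proof.
move=> uA hp; exists [seq x <- undup L | x \in A]; first exact: filter_subseq.
apply: uniq_perm; rewrite ?filter_uniq ?undup_uniq // => x.
by rewrite mem_filter mem_undup (perm_mem hp) mem_cat; case: (x \in A).
Qed.

Lemma sub_undup (A L : seq nat) : subseq A (undup L) ->
  exists D, perm_eq L (A ++ D).
Proof.
move=> hA; have [D hp] := perm_to_subseq (subseq_trans hA (undup_subseq L)).
by exists D.
Qed.

(* The compositions [z] counted below [c] are classified by the set [A] of
   parts whose sum is the first entry of [z]: [A] ranges over the nonempty
   subsets of the support of the block [B] belonging to the first entry
   of [c]. *)
Lemma first_block m L c : all (leq 1) L -> unique_sums L -> L != [::] ->
  fits m L c -> exists B, [/\ B != [::],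
    forall z, setsplits m L z -> refines z c ->
      exists2 A, subseq A (undup B) /\ A != [::] & head 0 z = sumn A,
    exists D, perm_eq L (B ++ D) &
    forall A D, subseq A (undup B) -> A != [::] -> perm_eq L (A ++ D) ->
      exists2 c', fits m D c' & forall z,
        setsplits m L (sumn A :: z) /\ refines (sumn A :: z) c <->
        setsplits m D z /\ refines z c'].
Proof.
move=> L1 uL L0; case: c => [/splits_nilN //|x s] h.
(* By unique sums, a first entry [sumn A] can only come from the block [A]. *)
have setE A D z : perm_eq L (A ++ D) -> uniq A -> A != [::] ->
    setsplits m L (sumn A :: z) <-> setsplits m D z.
  move=> hp uA a0; split=> [|hz]; last exact: splits_cons hp a0 uA hz.
  case/(setsplits_head L0) => A' [D' [z' [hp' _ _ hz [e ->]]]].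
  have hA := uL _ _ _ _ hp hp' e.
  by apply: splits_perm hz; perm_count.
have subU (A B : seq nat) : subseq A (undup B) -> uniq A.
  by move/subseq_uniq; apply; exact: undup_uniq.
case: s h => [|y s] h.
  (* Everything is merged into the pointed entry of [c], so any part may occur in the first
     block. *)
  have [E [hE _ ex]] := splits_single h; exists L; split=> //.
  - move=> z hz _; have [A [D [z' [hp a0 uA _ ->]]]] := setsplits_head L0 hz.
    have [A' hA' pA] := undup_sub uA hp.
    exists A'; last by rewrite -(perm_sumn pA).
    by split=> //; move: a0; rewrite -!size_eq0 (perm_size pA).
  - by exists [::]; rewrite cats0.
  move=> A D /subU uA a0 hp; exists [:: sumn D + m]; first exact: splits_last.
  have xE : x = sumn A + (sumn D + m).
    by rewrite ex -(perm_sumn hE) (perm_sumn hp) sumn_cat addnA.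
  move=> z; rewrite (setE _ _ _ hp) //; split=> -[hz hr]; split=> //.
    have := @refines_cons z [::] [::] _ refines_nil; rewrite cats0.
    rewrite (splits_sumn hz); apply; apply/eqP => z0.
    by rewrite z0 in hz; exact: splits_nilN hz.
  have := @refines_cons (sumn A :: z) [::] [::] isT refines_nil.
  by rewrite cats0 /= (splits_sumn hz) -xE.
have [B [R [hB b0 _ ex hR]]] := @splits_consE _ _ m L x (y :: s) isT h; subst x.
have pos A D : perm_eq L (A ++ D) -> A != [::] -> 0 < sumn A.
  by move=> hp; apply: sumn_gt0; move: L1; rewrite (all_perm_cat _ hp) => /andP[].
exists B; split=> //; last 2 first.
- by exists R.
- move=> A D hA a0 hp; have uA := subU _ _ hA.
  have [B' hB'] := sub_undup hA.
  have hD : perm_eq D (B' ++ R) by perm_count.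
  (* [B'] is what [A] leaves of [B]. If it is empty, [c'] is the tail of [c]; otherwise the first
     entry of [c] shrinks to [sumn B']. *)
  case: (eqVneq B' [::]) => [B'0|b'0].
    subst B'; rewrite cats0 in hB'; rewrite (perm_sumn hB').
    exists (y :: s); first by apply: splits_perm hR; rewrite perm_sym.
    move=> z; rewrite (setE _ _ _ hp) //.
    split=> -[hz hr]; split=> //; last first.
      by have := @refines_cons [:: sumn A] _ _ isT hr; rewrite /= addn0.
    (* The run with sum [sumn A] starts with [sumn A]; a second entry would be the sum of a nonempty
       block, hence positive, so there is none. *)
    have [u [r [er u0 eu hr']]] : exists u r,
        [/\ sumn A :: z = u ++ r, u != [::], sumn u = sumn A &
            refines r (y :: s)].
      by inversion hr as [|u r t u0 hr' e1 e2]; exists u, r.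
    case: u er u0 eu => // a u [<- ez] _ /= /eqP; rewrite -[X in _ == X]addn0.
    rewrite eqn_add2l => u00.
    case: u ez u00 => [-> //|b u ez]; move: hz; rewrite ez.
    case/splits_consE => [|A' [D' [hp' a'0 _ -> _]]].
      by rewrite -size_eq0 size_cat addn_eq0 !size_eq0 (refines_nilL hr') andbF.
    have: 0 < sumn A'.
      by apply: (pos _ (A ++ D')) => //; perm_count.
    by case: (sumn A').
  have sB : sumn B = sumn A + sumn B' by rewrite (perm_sumn hB') sumn_cat.
  exists (sumn B' :: y :: s); first exact: splits_cons hD b'0 isT hR.
  have B'pos : 0 < sumn B' by apply: (pos _ (A ++ R)) => //; perm_count.
  move=> z; rewrite (setE _ _ _ hp) //; split=> -[hz hr]; split=> //.
    inversion hr as [|u r t u0 hr' e1 [e2 e3]].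
    case: u u0 e1 e2 {hr} => // a u _ [-> <-] /= e.
    have eu : sumn B' = sumn u by apply: (@addnI (sumn A)); rewrite e.
    by rewrite eu; apply: refines_cons hr'; move: B'pos; rewrite eu; case: (u).
  rewrite sB; inversion hr as [|u r t u0 hr' e1 [e2 e3]]; subst.
  exact: (@refines_cons (sumn A :: u)).
move=> z hz hr; inversion hr as [|u r t u0 hr' e1 [e2 e3]]; subst.
have r0 : r != [::] by rewrite (refines_nilL hr').
case: u u0 hz hr e2 => // a u _ hz hr e2.
have [|A [D [hp a0 uA ea hz']]] := splits_consE _ hz.
  by case: u {hz hr e2}; case: r r0 {hr'}.
(* The blocks in the first run of [z] together have sum [sumn B], so by uniqueness they make up [B],
   which therefore contains [A]. *)
have [U [R' [hU eU _]]] := setsplits_cat r0 hz'.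
have hp2 : perm_eq L ((A ++ U) ++ R') by perm_count.
have hAU : perm_eq B (A ++ U).
  by apply: uL hB hp2 _; rewrite sumn_cat eU -ea -e2.
have [A' hA' pA] := undup_sub uA hAU.
exists A'; last by rewrite -(perm_sumn pA).
by split=> //; move: a0; rewrite -!size_eq0 (perm_size pA).
Qed.

(** Here [zs] lists the elements of V below [c]; multiplied by [(-1) ^+ size L], the identity is the
    one that [mob0_unique] asks for. *)
Lemma signed_count m L c (zs : seq (seq nat)) :
  all (leq 1) L -> unique_sums L -> fits m L c -> uniq zs ->
  (forall z, z \in zs <-> setsplits m L z /\ refines z c) ->
  (\sum_(z <- zs) (-1) ^+ size z = (-1) ^+ (size L).+1 :> int)%R.
Proof.
have [k] := ubnP (size L); elim: k L c zs => // k IH L c zs sL L1 uL hc uz hz.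
case: (eqVneq L [::]) => [L0|L0].
  (* Without parts, [[:: m]] is the only term, and its sign is -1. *)
  have cE : c = [:: m] by apply: splits_nil; rewrite -L0; exact: hc.
  have mz : [:: m] \in zs.
    apply/hz; rewrite cE L0; split; last exact: refines_refl.
    exact: (@splits_last _ _ m [::] [::]).
  rewrite (bigD1_seq _ mz) //= big_seq_cond big1 ?addr0 ?L0 // => z.
  by case/andP=> /hz[]; rewrite L0 => /splits_nil ->; rewrite eqxx.
have [B [b0 hex [R hB] hA]] := first_block L1 uL L0 hc.
set subs := [seq A <- sublists (undup B) | A != [::]].
have subsP A : A \in subs = subseq A (undup B) && (A != [::]).
  by rewrite mem_filter mem_sublists andbC.
have usubs : uniq subs by rewrite filter_uniq // uniq_sublists // undup_uniq.
have subL A : A \in subs -> exists D, perm_eq L (A ++ D).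
  rewrite subsP => /andP[/sub_undup[D hD] _]; exists (D ++ R); perm_count.
have injS : {in subs &, injective sumn}.
  move=> A A' hS hS' e; have [D hD] := subL _ hS; have [D' hD'] := subL _ hS'.
  have pA := uL _ _ _ _ hD hD' e; move: hS hS'; rewrite !subsP.
  case/andP=> /(subseq_uniqP (undup_uniq B)) -> _.
  case/andP=> /(subseq_uniqP (undup_uniq B)) -> _.
  by apply: eq_filter; exact: perm_mem.
(* Exactly one [A] fits each [z], so the sum can be regrouped by [A]. *)
have split1 z : z \in zs ->
    (\sum_(A <- subs | head 0%N z == sumn A) (-1) ^+ size z
     = (-1) ^+ size z :> int)%R.
  move=> /hz[h1 h2]; have [A [sA a0] ->] := hex z h1 h2.
  have hS : A \in subs by rewrite subsP sA.
  rewrite big_mkcond (bigD1_seq A) //= eqxx big_seq_cond big1 ?addr0 //.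
  move=> A' /andP[hS' ne]; case: eqP => // e; case/eqP: ne; exact: injS.
transitivity (\sum_(A <- subs) \sum_(z <- zs | head 0%N z == sumn A)
    (-1) ^+ size z : int)%R.
  rewrite (exchange_big_dep predT) //= big_seq [RHS]big_seq.
  by apply: eq_bigr => z /split1.
(* By [sign_sublists] the target is also a sum over [A]; its terms are what induction gives for [D],
   with a minus sign for the removed first entry. *)
have -> : ((-1) ^+ (size L).+1
    = \sum_(A <- subs) - ((-1) ^+ (size L).+1 * (-1) ^+ size A) :> int)%R.
  rewrite sumrN -mulr_sumr big_filter sign_sublists ?undup_uniq ?mulrN1 ?opprK //.
  apply: contra b0 => /eqP bE; rewrite -size_eq0 -leqn0 leqNgt -has_predT.
  by apply/hasPn => b; rewrite -mem_undup bE.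
rewrite big_seq [RHS]big_seq.
apply: eq_bigr => A hS; have := hS; rewrite subsP => /andP[sA a0].
have [D hD] := subL _ hS; have [c' hc' hE] := hA _ _ sA a0 hD.
have szL : size L = size A + size D by rewrite (perm_size hD) size_cat.
have zsE z : z \in [seq z <- zs | head 0 z == sumn A] -> z = sumn A :: behead z.
  rewrite mem_filter => /andP[/eqP <- /hz[h _]].
  by case: z h => // /splits_nilN.
have/andP[A1 D1] : all (leq 1) A && all (leq 1) D by rewrite -(all_perm_cat _ hD).
have := IH D c' [seq behead z | z <- zs & head 0 z == sumn A] _ D1
  (unique_sums_sub hD uL) hc' _ _.
rewrite big_map => IH'.
rewrite -big_filter (eq_big_seq (fun z => - (-1) ^+ size (behead z)) )%R; last first.
  by move=> z /zsE ->; rewrite /= exprS mulN1r.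
rewrite sumrN IH'.
- by rewrite szL -addnS exprD mulrAC -exprMn mulrNN mulr1 expr1n mul1r.
- by rewrite szL in sL; case: A a0 {hS sA hD hE szL zsE A1 IH'} sL => //= *; lia.
- rewrite map_inj_in_uniq ?filter_uniq // => z1 z2 /zsE -> /zsE -> /= -> //.
move=> z; rewrite -hE -hz; split.
  by case/mapP => z1 h1 ->; rewrite -zsE //; move: h1; rewrite mem_filter => /andP[].
by move=> h; apply/mapP; exists (sumn A :: z) => //; rewrite mem_filter eqxx.
Qed.

(** * The set V and the Möbius function *)

(** A decidable form of [inV], needed to define the candidate function by cases. *)
Definition inVb n L m c :=
  [&& c \in CF n L m, (ctype c).2 == m &
      all (fun ci => all (fun A => (sumn A == ci) ==> uniq A) (sublists L))
          (ctype c).1].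

Lemma inVP n L m c : reflect (inV n L m c) (inVb n L m c).
Proof.
apply: (iffP and3P) => [[cF /eqP lm /allP h]|[cF [/eqP lm h]]]; split=> //.
  split=> // ci /h /allP h' b e.
  by have := h' (mask b L); rewrite mem_sublists mask_subseq e eqxx; exact.
apply/allP => ci /h h'; apply/allP => A; rewrite mem_sublists.
by case/subseqP=> b _ ->; apply/implyP => /eqP; exact: h'.
Qed.

(** By unique sums, one repetition-free block with a given sum makes every submultiset with that sum
    repetition-free. A pointed entry equal to [m] leaves sum zero for the last block, which is empty
    as parts are positive. *)
Lemma setsplits_inV L m c : all (leq 1) L -> unique_sums L ->
  setsplits m L c <-> inV (sumn L + m) L m c.
Proof.
move=> L1 uL; have maskE b : exists D, perm_eq L (mask b L ++ D).
  by have [D] := perm_to_subseq (mask_subseq b L); exists D.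
split=> [h|[/(CFP _ _ L1) h [lm hu]]].
  split; first by apply/(CFP _ _ L1); exact: splits_sub h.
  have [-> hu] : (ctype c).2 = m /\ forall ci, ci \in (ctype c).1 ->
      exists A D, [/\ perm_eq L (A ++ D), sumn A = ci & uniq A].
    elim: h {L1 uL maskE} => {L c} [L [|//] _ _ //|L A D c hp a0 uA h [IH1 IH2]].
    case: c h IH1 IH2 => [/splits_nilN //|x s] _ /= -> IH2; split=> // ci.
    rewrite inE => /predU1P[->|/IH2[A' [D' [hp' <- uA']]]]; first by exists A, D.
    by exists A', (A ++ D'); split=> //; perm_count.
  split=> // ci /hu[A [D [hp <- uA]]] b e; have [D' hp'] := maskE b.
  by rewrite (perm_uniq (uL _ _ _ _ hp' hp e)).
have {}hu : forall ci, ci \in (ctype c).1 -> forall A D,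
    perm_eq L (A ++ D) -> sumn A = ci -> uniq A.
  move=> ci /hu h' A D hp e.
  have [|A' /subseqP[b _ ->] pA] := (count_subseqP A L).1.
    by move=> x; rewrite (permP hp) count_cat leq_addr.
  by rewrite (perm_uniq pA); apply: h'; rewrite -(perm_sumn pA).
elim: h L1 lm hu {uL maskE} => {L c} [L E hp _ L1 /= e _|L A D c hp a0 _ h IH].
  have E0 : E = [::].
    case: E hp e => // a E hp e; have := @sumn_gt0 (a :: E); rewrite -(perm_all _ hp).
    by rewrite L1 => /(_ isT isT); lia.
  by rewrite E0 in hp *; exact: splits_last.
rewrite (all_perm_cat _ hp) => /andP[_ D1] lm hu.
apply: (splits_cons hp a0).
  apply: (hu (sumn A) _ A D hp) => //.
  by case: c h {IH lm hu} => [/splits_nilN //|x s] _; exact: mem_head.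
apply: (IH D1).
  by case: c h lm {hu IH} => [/splits_nilN|x s].
move=> ci hci A' D' hp' e; apply: (hu ci _ A' (A ++ D')) => //.
  by case: c h hci {lm hu IH} => [/splits_nilN //|x s] _ /=; rewrite inE orbC => ->.
by perm_count.
Qed.

Theorem theorem4p4 (n : nat) (lam : seq nat) (m : nat) (c : seq nat) :
  pknapsack n lam m ->
  c \in CF n lam m ->
  (inV n lam m c ->
     mob0 cle (CF n lam m) c = ((-1) ^ ((size lam)%:Z - (size c)%:Z))%R) /\
  (~ inV n lam m c -> mob0 cle (CF n lam m) c = 0%R).
Proof.
case=> lam1 [<- {n} /knapsack_unique ulam] cF; set n := sumn lam + m.
(* The product of two natural powers stands for the sign with exponent [size lam - size z], which
   can be negative. *)
pose g z : int :=
  (if inVb n lam m z then (-1) ^+ size lam * (-1) ^+ size z else 0)%R.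
have uCF : uniq (CF n lam m) by rewrite filter_uniq // undup_uniq.
have sgn k : ((-1) ^+ k * (-1) ^+ k = 1 :> int)%R.
  by rewrite -exprMn mulrNN mulr1 expr1n.
have -> : mob0 cle (CF n lam m) c = g c.
  apply: mob0_unique cF => //.
  - by move=> z _; apply/cleP; exact: refines_refl.
  - move=> y x z _ _ _ /cleP xy /cleP yz; apply/cleP; exact: refines_trans yz.
  - by move=> x y _ _ /andP[/cleP xy /cleP yx]; exact: refines_antisym.
  move=> d /(CFP _ _ lam1) hd.
  pose zs := [seq z <- CF n lam m | cle z d & inVb n lam m z].
  have uzs : uniq zs by exact: filter_uniq.
  rewrite -big_mkcondr -big_filter -/zs -mulr_sumr.
  rewrite (signed_count lam1 ulam hd uzs).
    by rewrite exprS mulrCA sgn mulr1.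
  move=> z; rewrite mem_filter setsplits_inV //; split.
    by case/andP=> /andP[/cleP zd /inVP].
  case=> zV /cleP ->; rewrite andTb (introT (inVP _ _ _ _) zV).
  by case: zV.
rewrite /g; split=> [/inVP ->|/inVP /negPf -> //].
(* The exponent is a natural number unless [c] has [(size lam).+1] entries, the largest possible
   length, where it is -1. *)
case: (leqP (size c) (size lam)) => le_c.
  by rewrite subzn // -[X in (_ ^+ X * _)%R](subnK le_c) exprD -mulrA sgn mulr1.
have -> : size c = (size lam).+1.
  apply/eqP; rewrite eqn_leq le_c andbT.
  by apply: splits_size; apply/CFP; [exact: lam1|exact: cF].
have -> : ((size lam)%:Z - (size lam).+1%:Z = - 1)%R by lia.
by rewrite exprS mulrCA sgn.
Qed.
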